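(* For every integer $n\ge 2$, $$\liminf_{H\to\infty}\frac{D_n^*(H)}{(2H)^{n+1}}\ \ge\ \frac{1}{3n^2\sqrt{n+1}}$$ and $$\limsup_{H\to\infty}\frac{D_n^*(H)}{(2H)^{n+1}}\ \le\ \begin{cases}1-\dfrac{1}{3\cdot 2^{3n/2-1}} & \text{if } n \text{ is even},\\[2mm] 1-\dfrac{1}{3\cdot 2^{(3n+1)/2}} & \text{if } n\text{ is odd},\end{cases}$$ where, for a positive integer $H$, $D_n^*(H)$ denotes the number of dominant polynomials $f(X)=a_0X^n+a_1X^{n-1}+\cdots+a_n\in\mathbb{Z}[X]$ with $a_0\ne 0$ and $|a_i|\le H$ for $i=0,1,\ldots,n$.
   Context: A polynomial $f\in\mathbb{C}[X]$ of degree $n\ge 2$ with roots $\alpha_1,\ldots,\alpha_n\in\mathbb{C}$ (listed with multiplicity) is called dominant if there is an index $i$ such that $|\alpha_i|>|\alpha_j|$ for all $j\ne i$; equivalently, $f$ has a simple root whose modulus is strictly greater than the moduli of all its remaining roots. $H$ runs through positive integers. *)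

(* Defs.v *)
From HB Require Import structures.
From mathcomp Require Import all_boot all_order all_algebra finmap.
From mathcomp Require Import all_classical all_reals all_analysis.
From mathcomp Require Import complex.

Set Implicit Arguments.
Unset Strict Implicit.
Unset Printing Implicit Defensive.

Import Order.TTheory GRing.Theory Num.Theory.
Local Open Scope classical_set_scope.
Local Open Scope ring_scope.
Local Open Scope complex_scope.

(* [size f] is one more than the degree, so that the roots of f, with
   multiplicity, form a family indexed by ['I_(size f).-1].  The norm of R[i]
   takes values in R[i]; they are real, and [<] on R[i] compares real numbers
   as usual. *)
Definition dominant (R : realType) (f : {poly R[i]}) : Prop :=
  (2 < size f)%N /\
  exists alpha : 'I_(size f).-1 -> R[i],
    f = lead_coef f *: \prod_i ('X - (alpha i)%:P) /\
    exists i, forall j, j != i -> `|alpha j| < `|alpha i|.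

(* In the usual notation f = a_0 X^n + ... + a_n, the coefficient f`_k is
   a_(n-k), and the size condition means that the degree is n, i.e. a_0 <> 0. *)
Definition dominant_box (R : realType) (n H : nat) : set {poly int} :=
  [set f : {poly int} | [/\ size f = n.+1, forall k, (k <= n)%N -> `|f`_k| <= H%:Z
             & dominant (map_poly (intr : int -> R[i]) f)]].

(* [fset_set] of an infinite set would be empty. *)
Lemma finite_dominant_box (R : realType) (n H : nat) :
  finite_set (dominant_box R n H).
Proof.
pose p (a : {ffun 'I_n.+1 -> 'I_(2 * H).+1}) : {poly int} :=
  \poly_(i < n.+1) ((a (inord i) : nat)%:Z - H%:Z).
apply: (@sub_finite_set _ _ (p @` setT)); last first.
  exact/finite_image/finite_finset.
move=> f [sf bf _].
exists [ffun i : 'I_n.+1 => inord (absz (f`_i + H%:Z))] => //.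
apply/polyP => k; rewrite coef_poly; case: ltnP => hk; last first.
  by rewrite nth_default // sf.
have := bf k hk; rewrite ler_norml => /andP[lo hi].
have ge0 : 0 <= f`_k + H%:Z by rewrite addrC -lerBlDl sub0r.
rewrite ffunE inordK inordK //; first by rewrite gez0_abs // addrK.
by rewrite ltnS -lez_nat gez0_abs // mulSn mul1n PoszD lerD.
Qed.

Definition num_dominant (R : realType) (n H : nat) : nat :=
  #|` fset_set (dominant_box R n H)|.

(* The value at H = 0, where division by zero gives 0, does not affect the
   limits inferior and superior. *)
Definition dominant_ratio (R : realType) (n H : nat) : R :=
  (num_dominant R n H)%:R / (2 * H%:R) ^+ n.+1.

(* In each case the division of the exponent by 2 is exact. *)
Definition upper_density (R : realType) (n : nat) : R :=
  if odd n then 1 - 1 / (3 * 2 ^+ ((3 * n + 1) %/ 2)%N)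
  else 1 - 1 / (3 * 2 ^+ (3 * n %/ 2 - 1)%N).

(* Main.v *)
Require Import Defs.
From mathcomp Require Import all_boot all_order all_algebra finmap.
From mathcomp Require Import all_classical all_reals all_analysis.
From mathcomp Require Import complex polyrcf perm zify ring lra.
Import Order.TTheory GRing.Theory Num.Theory.
Local Open Scope ring_scope.

(** Lower bound.  If [3 |a_1| > 12 |a_0| + H], then on the circle [|z| = 4] the
    term [a_1 z^(n-1)] dominates the sum of the others (Pellet's condition).
    The real polynomial [f] changes sign between [4] or [-4] and infinity, so it
    has a real root of modulus greater than 4, and the cofactor of that root has
    all its roots in [|z| < 4].  This region has density
    [1/18 > 1/20 >= 1 / (3 n^2 sqrt (n+1))].

    Upper bound.  Suppose that [0 < a_0 <= a_n] and that [|a_(2k+1)| <= a_(2k)]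
    for all [k], strictly for [k = 0].  Then [f] has no real root of modulus at
    least 1.  A dominant root of a real polynomial is real, and its modulus is at
    least the geometric mean [(a_n / a_0)^(1/n) >= 1] of all the moduli, so
    neither [f] nor [-f] is dominant.  A bijective parametrization of the pairs
    [(a_(2k), a_(2k+1))] by [0, H)^2 turns the remaining condition [a_0 <= a_n]
    into one on which coordinates are largest, which by symmetry holds for one
    third of the parameters if [n] is even; if [n] is odd, requiring also
    [0 < a_n <= a_(n-1)], it holds for one twelfth of them. *)

(** * Moduli of complex numbers *)

Lemma normcN (R : rcfType) (z : R[i]) : Normc.normc (- z) = Normc.normc z.
Proof. by case: z => a b; rewrite /Normc.normc /= !sqrrN. Qed.

Lemma normr_normc (R : rcfType) (z : R[i]) : `|z| = (Normc.normc z)%:C%C.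
Proof. by []. Qed.

Lemma normc_real_complex (R : rcfType) (x : R) : Normc.normc x%:C%C = `|x|.
Proof. by rewrite /Normc.normc /= expr0n addr0 sqrtr_sqr. Qed.

Lemma normcX (R : rcfType) (z : R[i]) k :
  Normc.normc (z ^+ k) = Normc.normc z ^+ k.
Proof.
by apply: complexI; rewrite rmorphXn /= -!normr_normc normrX.
Qed.

Lemma normc_ge0 (R : rcfType) (z : R[i]) : 0 <= Normc.normc z.
Proof. by case: z => a b; exact: sqrtr_ge0. Qed.

Lemma normc_sum (R : rcfType) I (s : seq I) (F : I -> R[i]) :
  Normc.normc (\sum_(i <- s) F i) <= \sum_(i <- s) Normc.normc (F i).
Proof.
elim/big_rec2: _ => [|i x y _ h]; first by rewrite Normc.normc0.
by apply: le_trans (le_normcD _ _) _; rewrite lerD2l.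
Qed.

Lemma le_normcB (R : rcfType) (x y : R[i]) :
  Normc.normc (x - y) <= Normc.normc x + Normc.normc y.
Proof. by apply: le_trans (le_normcD _ _) _; rewrite normcN. Qed.

(** * Pellet's inequality as a sufficient condition *)

(* The uniqueness part of Pellet's theorem.  The recursion
   [r * g_k = g_(k-1) - f_k] bounds the lower coefficients of [g] at radius [t]
   by the leading one, so [g] has no root outside the disc of radius [t]. *)
Lemma pellet_cofactor_root (R : rcfType) (g : {poly R[i]}) (r z : R[i]) (t : R)
    (n : nat) (f := ('X - r%:P) * g) :
  size g = n.+2 -> 0 < t -> t < Normc.normc r ->
  Normc.normc f`_n.+2 * t ^+ n.+2 + \sum_(k < n.+1) Normc.normc f`_k * t ^+ k
    < Normc.normc f`_n.+1 * t ^+ n.+1 ->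
  root g z -> Normc.normc z < t.
Proof.
move=> sg t0 tr.
set S := \sum_(k < _) _; set rho := Normc.normc r in tr *.
have fE k : f`_k = (if k is j.+1 then g`_j else 0) - r * g`_k.
  by rewrite /f mulrBl coefB coefXM coefCM; case: k.
pose G := \sum_(k < n.+1) Normc.normc g`_k * t ^+ k.
have tX_ge0 k : 0 <= t ^+ k by rewrite exprn_ge0 ?ltW.
set T := t ^+ n.+1; rewrite [t ^+ n.+2]exprS -/T.
have T0 : 0 < T by rewrite exprn_gt0.
have -> : Normc.normc f`_n.+2 = Normc.normc g`_n.+1.
  by rewrite fE [g`_n.+2]nth_default ?sg// mulr0 subr0.
have h2 : Normc.normc f`_n.+1 <= Normc.normc g`_n + rho * Normc.normc g`_n.+1.
  by rewrite /rho -Normc.normcM fE; exact: le_normcB.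
(* The triangle inequality in the recursion, weighted by [t ^+ k] and summed over [k <= n]; shifting
   the index costs a factor [t] and drops the top term of [G]. *)
have h1 : rho * G <= t * (G - Normc.normc g`_n * t ^+ n) + S.
  have -> : t * (G - Normc.normc g`_n * t ^+ n) =
      \sum_(k < n.+1) Normc.normc (if k : nat is j.+1 then g`_j else 0) * t ^+ k.
    rewrite /G big_ord_recr /= addrK big_ord_recl /= expr0n addr0 sqrtr0.
    rewrite mul0r add0r mulr_sumr; apply: eq_bigr => k _.
    by rewrite /bump add0n add1n exprS mulrCA.
  rewrite /S -big_split /= mulr_sumr; apply: ler_sum => k _.
  rewrite mulrA -mulrDl ler_wpM2r ?tX_ge0//.
  rewrite /rho -Normc.normcM.
  have -> : r * g`_k = (if k : nat is j.+1 then g`_j else 0) - f`_k.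
    by rewrite fE opprB addrC subrK.
  exact: le_normcB.
move=> h3.
have h2' := ler_wpM2r (ltW T0) h2.
have TE : T = t * t ^+ n by rewrite /T exprS.
(* Chaining [h1], [h3] and [h2'] bounds [(rho - t) * G] by [(rho - t)] times the leading term. *)
have GT : G < Normc.normc g`_n.+1 * T.
  have h0 : 0 < rho - t by rewrite subr_gt0.
  rewrite -(ltr_pM2l h0).
  move: h1 h2' h3; rewrite TE.
  set a := t ^+ n; set b := Normc.normc g`_n; set c := Normc.normc g`_n.+1.
  by set d := Normc.normc f`_n.+1 => h1 h2' h3; lra.
move=> /rootP gz; rewrite ltNge; apply/negP => tz.
set zeta := Normc.normc z in tz.
have z0 : 0 < zeta by apply: lt_le_trans tz.
have hz : Normc.normc g`_n.+1 * zeta ^+ n.+1 <=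
    \sum_(k < n.+1) Normc.normc g`_k * zeta ^+ k.
  have -> : Normc.normc g`_n.+1 * zeta ^+ n.+1 =
      Normc.normc (\sum_(k < n.+1) g`_k * z ^+ k).
    move: gz; rewrite horner_coef sg big_ord_recr /= => /eqP.
    rewrite addr_eq0 => /eqP ->.
    by rewrite normcN Normc.normcM normcX.
  apply: le_trans (normc_sum _ _ _ _) _.
  by apply: ler_sum => k _; rewrite Normc.normcM normcX.
(* If [t <= zeta], then [t ^+ n * zeta ^+ k <= t ^+ k * zeta ^+ n] for [k <= n]. Hence [GT] carries
   over from radius [t] to radius [zeta], where it contradicts [hz]. *)
have hG : t ^+ n * (\sum_(k < n.+1) Normc.normc g`_k * zeta ^+ k) <= G * zeta ^+ n.
  rewrite mulr_sumr mulr_suml; apply: ler_sum => k _.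
  rewrite mulrCA -!mulrA ler_wpM2l ?normc_ge0//.
  have kn : (k <= n)%N by rewrite -ltnS.
  have nE : (n = k + (n - k))%N by rewrite subnKC.
  have pw (x : R) : x ^+ n = x ^+ k * x ^+ (n - k) by rewrite {1}nE exprD.
  rewrite (pw t) (pw zeta) -mulrA ler_wpM2l ?tX_ge0// mulrC ler_wpM2l ?exprn_ge0 ?(ltW z0)//.
  by rewrite lerXn2r ?nnegrE ?(ltW t0) ?(ltW z0).
have := ler_wpM2l (exprn_ge0 n (ltW t0)) hz.
apply/negP; rewrite -ltNge.
apply: le_lt_trans hG _.
have zn0 : 0 < zeta ^+ n by rewrite exprn_gt0.
apply: (@lt_le_trans _ _ (Normc.normc g`_n.+1 * T * zeta ^+ n)).
  by rewrite ltr_pM2r.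
have zS : zeta ^+ n.+1 = zeta * zeta ^+ n by rewrite exprS.
have h : 0 <= Normc.normc g`_n.+1 * t ^+ n * zeta ^+ n.
  by rewrite !mulr_ge0 ?normc_ge0 ?tX_ge0// ltW.
by have := ler_wpM2r h tz; rewrite TE zS; lra.
Qed.

(** The negative term of degree [n.+1] outweighs the others at [t], so [q] is negative there; it is
    positive near infinity, and the intermediate value theorem applies. *)
Lemma real_root_gt_of_sign (R : rcfType) (q : {poly R}) (t : R) (n : nat) :
  size q = n.+3 -> 0 < t -> 0 < q`_n.+2 -> q`_n.+1 < 0 ->
  `|q`_n.+2| * t ^+ n.+2 + \sum_(k < n.+1) `|q`_k| * t ^+ k
    < `|q`_n.+1| * t ^+ n.+1 ->
  exists2 x, root q x & t < x.
Proof.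
move=> sq t0 lc_gt0 slc_lt0.
rewrite (gtr0_norm lc_gt0) (ltr0_norm slc_lt0) => pel.
have qt_lt0 : q.[t] < 0.
  rewrite horner_coef sq 2!big_ord_recr /=.
  have : \sum_(k < n.+1) q`_k * t ^+ k <= \sum_(k < n.+1) `|q`_k| * t ^+ k.
    by apply: ler_sum => k _; rewrite ler_wpM2r ?ler_norm// exprn_ge0 // ltW.
  by move: pel; lra.
have lc0 : 0 < lead_coef q by rewrite lead_coefE sq.
have [M hM] := poly_pinfty_gt_lc lc0.
have [||x /andP[tx _] rx] := @poly_ivt R q t (Num.max t M).
- by rewrite le_max lexx.
- rewrite (ltW qt_lt0) /=; apply: le_trans (ltW lc0) (hM _ _).
  by rewrite le_max lexx orbT.
- exists x => //; rewrite lt_neqAle tx andbT; apply/eqP => tE.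
  by move: qt_lt0; rewrite tE (rootP rx) ltxx.
Qed.

(** Reduction to the previous signs: [p] is the polynomial [c * q(e * x)]. The sign [e] makes its
    second coefficient negative, and the factor [c] makes its leading coefficient a square. *)
Lemma real_root_norm_gt (R : rcfType) (q : {poly R}) (t : R) (n : nat) :
  size q = n.+3 -> 0 < t ->
  `|q`_n.+2| * t ^+ n.+2 + \sum_(k < n.+1) `|q`_k| * t ^+ k
    < `|q`_n.+1| * t ^+ n.+1 ->
  exists2 x, root q x & t < `|x|.
Proof.
move=> sq t0 pel.
have lc0 : q`_n.+2 != 0.
  by have := lead_coef_eq0 q; rewrite lead_coefE sq /= => ->; rewrite -size_poly_eq0 sq.
have slc0 : q`_n.+1 != 0.
  apply/eqP => h; move: pel; rewrite h normr0 mul0r; apply/negP; rewrite -leNgt.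
  apply: addr_ge0; first by rewrite mulr_ge0 // exprn_ge0 // ltW.
  apply: sumr_ge0 => k _.
  by rewrite mulr_ge0 // exprn_ge0 // ltW.
pose e := - Num.sg (q`_n.+2 * q`_n.+1).
have e2 : e * e = 1.
  by rewrite /e mulrNN -expr2 sqr_sg mulf_neq0.
have ne : `|e| = 1 by rewrite /e normrN normr_sg mulf_neq0.
pose c := q`_n.+2 * e ^+ n.
pose p := \poly_(i < n.+3) (c * e ^+ i * q`_i).
have pk k : (k < n.+3)%N -> p`_k = c * e ^+ k * q`_k by move=> h; rewrite coef_poly h.
have p_lc : p`_n.+2 = q`_n.+2 ^+ 2.
  rewrite pk // /c [e ^+ n.+2]exprSr [e ^+ n.+1]exprSr.
  have en : e ^+ n * e ^+ n = 1 by rewrite -exprMn e2 expr1n.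
  transitivity (q`_n.+2 ^+ 2 * (e ^+ n * e ^+ n) * (e * e)); first by ring.
  by rewrite en e2 !mulr1.
have p_slc : p`_n.+1 = - `|q`_n.+2 * q`_n.+1|.
  rewrite pk // /c [e ^+ n.+1]exprSr.
  have en : e ^+ n * e ^+ n = 1 by rewrite -exprMn e2 expr1n.
  transitivity (q`_n.+2 * q`_n.+1 * (e ^+ n * e ^+ n) * e); first by ring.
  by rewrite en mulr1 /e mulrN [_ * Num.sg _]mulrC -normrEsg.
have npk k : (k < n.+3)%N -> `|p`_k| = `|q`_n.+2| * `|q`_k|.
  by move=> h; rewrite pk // /c !normrM !normrX ne !expr1n !mulr1.
have sp : size p = n.+3.
  by rewrite size_poly_eq //= -pk // p_lc expf_neq0.
have [|||x rx tx] := @real_root_gt_of_sign R p t n sp t0.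
- by rewrite p_lc exprn_even_gt0 //= lc0.
- by rewrite p_slc oppr_lt0 normr_gt0 mulf_neq0.
- rewrite !npk //.
  have -> : \sum_(k < n.+1) `|p`_k| * t ^+ k =
      `|q`_n.+2| * \sum_(k < n.+1) `|q`_k| * t ^+ k.
    rewrite mulr_sumr; apply: eq_bigr => k _; rewrite npk ?mulrA//.
    by apply: ltn_trans (ltn_ord k) _.
  by rewrite -!mulrA -mulrDr ltr_pM2l // normr_gt0.
exists (e * x); last by rewrite normrM ne mul1r (lt_le_trans tx) ?ler_norm.
move/rootP: rx; rewrite horner_poly => px.
have : c * q.[e * x] = 0.
  rewrite -[RHS]px horner_coef sq mulr_sumr; apply: eq_bigr => i _.
  by rewrite exprMn; ring.
move/eqP; rewrite mulf_eq0 => /orP[|//].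
rewrite /c mulf_eq0 (negPf lc0) /= expf_eq0 => /andP[_ /eqP e0].
by move: e2; rewrite e0 mul0r => /eqP; rewrite eq_sym oner_eq0.
Qed.

Lemma dominant_of_pellet (R : realType) (q : {poly R}) (t : R) (n : nat) :
  size q = n.+3 -> 0 < t ->
  `|q`_n.+2| * t ^+ n.+2 + \sum_(k < n.+1) `|q`_k| * t ^+ k
    < `|q`_n.+1| * t ^+ n.+1 ->
  dominant (map_poly (real_complex R) q).
Proof.
move=> sq t0 pel; set f := map_poly _ q.
have sf : size f = n.+3 by rewrite size_map_poly.
have [x rx tx] := @real_root_norm_gt R q t n sq t0 pel.
split; first by rewrite sf.
have [r fE] := closed_field_poly_normal f.
have lc0 : lead_coef f != 0 by rewrite lead_coef_eq0 -size_poly_eq0 sf.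
have sr : size r = (size f).-1 by rewrite fE size_scale // size_prod_XsubC.
have rf : root f x%:C%C by rewrite /f (fmorph_root (real_complex R)).
have xr : x%:C%C \in r.
  by move: rf; rewrite fE rootZ // root_prod_XsubC.
pose alpha (i : 'I_(size f).-1) := r`_i.
have fE' : f = lead_coef f *: \prod_i ('X - (alpha i)%:P).
  rewrite {1}fE; congr (_ *: _).
  by rewrite (big_nth 0) big_mkord sr.
exists alpha; split => //.
have ilt : (index x%:C%C r < (size f).-1)%N by rewrite -sr index_mem.
exists (Ordinal ilt) => j ji.
have ai : alpha (Ordinal ilt) = x%:C%C by rewrite /alpha /= nth_index.
rewrite ai.
(* Only one occurrence of [x] is removed, so a repeated root [x] would still be a root of [g] and is
   excluded as well. *)
pose g := lead_coef f *: \prod_(i | i != Ordinal ilt) ('X - (alpha i)%:P).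
have fg : f = ('X - (x%:C%C)%:P) * g.
  by rewrite {1}fE' (bigD1 (Ordinal ilt)) //= ai /g -scalerAr.
have sg : size g = n.+2.
  have g0 : g != 0 by apply/eqP => g0; move: sf; rewrite fg g0 mulr0 size_poly0.
  by move: sf; rewrite fg size_monicM ?monicXsubC // size_XsubC => -[].
have gj : root g (alpha j).
  rewrite rootZ // /root (bigD1 j) //= hornerM.
  by rewrite hornerXsubC subrr mul0r.
have nf k : Normc.normc f`_k = `|q`_k|.
  by rewrite coef_map normc_real_complex.
rewrite !normr_normc ltcR normc_real_complex.
apply: (lt_trans _ tx).
apply: (@pellet_cofactor_root R g x%:C%C (alpha j) t n) => //.
  by rewrite normc_real_complex.
rewrite -fg !nf; congr (_ + _ < _): pel.
by apply: eq_bigr => k _; rewrite nf.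
Qed.

Lemma map_poly_intr_complex (R : rcfType) (f : {poly int}) :
  map_poly (intr : int -> R[i]) f =
  map_poly (real_complex R) (map_poly (intr : int -> R) f).
Proof.
apply/polyP => k; rewrite !coef_map.
transitivity ((f`_k)%:~R : R[i]) => //.
by rewrite -(rmorph_int (real_complex R)).
Qed.

(** * Obstructions to dominance *)

(* A root of strictly maximal modulus equals its complex conjugate; the product
   formula for the constant coefficient then bounds its modulus from below. *)
Lemma dominant_real_root (R : realType) (q : {poly R}) :
  dominant (map_poly (real_complex R) q) ->
  exists2 x, root q x & `|q`_0| <= `|lead_coef q| * `|x| ^+ (size q).-1.
Proof.
set f := map_poly _ q => -[_ [alpha [fE [i hi]]]].
have rootE z : root f z -> lead_coef f != 0 -> exists j, alpha j = z.
  rewrite {1}fE => rz lc0; move: rz; rewrite rootZ // => /rootP/eqP.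
  rewrite horner_prod => /prodf_eq0[j _].
  by rewrite hornerXsubC subr_eq0 => /eqP h; exists j.
have [q0|qn0] := eqVneq q 0.
  by exists 0; rewrite q0 ?root0 // coef0 lead_coef0 normr0 mul0r.
have lc0 : lead_coef f != 0.
  by rewrite lead_coef_eq0 map_poly_eq0.
have fz : root f (alpha i).
  by rewrite fE rootZ // /root horner_prod (bigD1 i) //= hornerXsubC subrr mul0r.
have fc : map_poly conjc f = f.
  by apply/polyP => k; rewrite 2!coef_map; exact: conjc_real.
have [j aj] : exists j, alpha j = ((alpha i)^*)%C.
  apply: rootE lc0; rewrite -complex_root_conj fc //.
have ji : j = i.
  by apply/eqP; apply: contraT => /hi; rewrite aj normcJ ltxx.
have [x ax] : exists x : R, alpha i = x%:C%C.
  move: aj; rewrite ji; case: (alpha i) => a b [] hb; exists a.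
  by congr (_ +i* _)%C; lra.
exists x; first by move: fz; rewrite ax /f (fmorph_root (real_complex R)).
have hle k : Normc.normc (alpha k) <= `|x|.
  rewrite -normc_real_complex -ax -lecR -!normr_normc.
  by have [->//|/hi/ltW] := eqVneq k i.
rewrite -normc_real_complex -[X in _ <= X * _]normc_real_complex.
have -> : (q`_0)%:C%C = f`_0 by rewrite coef_map.
have -> : (lead_coef q)%:C%C = lead_coef f by rewrite lead_coef_map.
rewrite -horner_coef0 {1}fE hornerZ Normc.normcM ler_wpM2l ?normc_ge0//.
rewrite horner_prod -lecR -normr_normc normr_prod.
have -> : (size q).-1 = (size f).-1 by rewrite size_map_poly.
rewrite rmorphXn /= -[X in _ ^+ X]card_ord -prodr_const.
apply: ler_prod => k _; rewrite normr_ge0 /= hornerXsubC sub0r normrN.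
by rewrite normr_normc lecR hle.
Qed.

(** Since [b * x >= - a * |x|], the product is at least [a * |x| * (|x| - 1)]. *)
Lemma pair_ge0 (R : realFieldType) (x a b : R) :
  1 <= `|x| -> `|b| <= a -> 0 <= x * (b + a * x).
Proof.
move=> x1 ba; have -> : x * (b + a * x) = a * `|x| ^+ 2 + b * x.
  by rewrite real_normK ?num_real//; ring.
have : - (b * x) <= `|b| * `|x| by rewrite -normrM -normrN ler_norm.
have := ler_wpM2r (normr_ge0 x) ba.
have : 0 <= a * `|x| * (`|x| - 1).
  by rewrite !mulr_ge0 ?subr_ge0//; apply: le_trans ba.
by lra.
Qed.

Lemma pair_gt0 (R : realFieldType) (x a b : R) :
  1 <= `|x| -> `|b| < a -> 0 < x * (b + a * x).
Proof.
move=> x1 ba; have -> : x * (b + a * x) = a * `|x| ^+ 2 + b * x.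
  by rewrite real_normK ?num_real//; ring.
have x0 : 0 < `|x| by lra.
have : - (b * x) <= `|b| * `|x| by rewrite -normrM -normrN ler_norm.
have := ba; rewrite -(ltr_pM2r x0).
have : 0 <= a * `|x| * (`|x| - 1).
  by rewrite !mulr_ge0 ?subr_ge0//; apply: le_trans (ltW ba).
by lra.
Qed.

Lemma sum_doubleS (R : realFieldType) (d : nat -> R) (m : nat) (x : R) :
  x * \sum_(k < m.+1.*2) d k * x ^+ k =
  x * \sum_(k < m.*2) d k * x ^+ k +
  (x ^+ m) ^+ 2 * (x * (d m.*2 + d m.*2.+1 * x)).
Proof.
rewrite doubleS !big_ord_recr /= exprS -exprM mulnC mul2n.
by ring.
Qed.

Lemma sum_pairs_ge0 (R : realFieldType) (d : nat -> R) (m : nat) (x : R) :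
  1 <= `|x| -> (forall j, (j < m)%N -> `|d j.*2| <= d j.*2.+1) ->
  0 <= x * \sum_(k < m.*2) d k * x ^+ k.
Proof.
move=> x1; elim: m => [|m IH] hd; first by rewrite big_ord0 mulr0.
rewrite sum_doubleS addr_ge0 //; first by apply: IH => j jm; apply/hd/ltnW.
by rewrite mulr_ge0 ?sqr_ge0 ?pair_ge0 ?hd.
Qed.

(** After multiplication by [x], consecutive terms pair up from the top into nonnegative blocks. For
    odd [n] all terms are paired and the top block is positive; for even [n] the positive constant
    coefficient is left over. Either way [x] is no root. The factor [c] serves to treat [f] and its
    opposite together. *)
Lemma not_dominant (R : realType) (n : nat) (f : {poly int}) (c : int) :
  (0 < n)%N -> c != 0 -> size f = n.+1 -> 0 < f`_n -> f`_n <= f`_0 ->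
  (forall i, (i < n)%N -> odd (n - i) -> `|f`_i| <= f`_i.+1) ->
  (odd n -> `|f`_n.-1| < f`_n) ->
  ~ dominant (map_poly (intr : int -> R[i]) (c *: f)).
Proof.
move=> n_gt0 c0 sf fn0 fn_le pairs strict.
pose q : {poly R} := map_poly intr f.
have -> : map_poly (intr : int -> R[i]) (c *: f) =
    map_poly (real_complex R) (c%:~R *: q).
  by rewrite map_poly_intr_complex; congr map_poly; apply/polyP => k;
    rewrite !(coef_map, coefZ) /= intrM.
have cR0 : (c%:~R : R) != 0 by rewrite intr_eq0.
have sq : size q = n.+1 by rewrite size_map_inj_poly ?rmorph0//; exact: intr_inj.
move=> /dominant_real_root[x]; rewrite rootZ // => /rootP qx.
rewrite lead_coefZ size_scale // sq coefZ !normrM -mulrA ler_pM2l ?normr_gt0//.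
have qk k : q`_k = (f`_k)%:~R by rewrite coef_map.
rewrite lead_coefE sq /= !qk => hx.
have fnR : (0 : R) < (f`_n)%:~R by rewrite ltr0z.
have fleR : ((f`_n)%:~R : R) <= (f`_0)%:~R by rewrite ler_int.
(* If [|x| < 1], then [f_n * |x|^n < f_n <= f_0], against [hx]. *)
have x1 : 1 <= `|x|.
  rewrite leNgt; apply/negP => xlt; move: hx; apply/negP; rewrite -ltNge.
  rewrite (gtr0_norm fnR) (gtr0_norm (lt_le_trans fnR fleR)).
  by apply: lt_le_trans fleR; rewrite gtr_pMr // exprn_ilt1 // -lt0n.
have pairsR i : (i < n)%N -> odd (n - i) -> `|q`_i| <= q`_i.+1.
  by move=> h1 h2; rewrite !qk -intr_norm ler_int pairs.
move: qx; rewrite horner_coef sq.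
have [on|en] := boolP (odd n).
  have nE : n = n./2.*2.+1 by rewrite -[LHS]odd_double_half on.
  move=> qx.
  have : 0 < x * \sum_(k < n./2.+1.*2) q`_k * x ^+ k.
    rewrite (sum_doubleS _ (fun k => q`_k)) ltr_wpDl //.
      apply: (sum_pairs_ge0 _ (fun k => q`_k)) => // j jm; apply: pairsR.
        by rewrite nE; lia.
      by rewrite oddB ?on ?odd_double//; lia.
    rewrite mulr_gt0 //.
      by rewrite exprn_even_gt0 //= expf_neq0 // -normr_gt0; lra.
    apply: pair_gt0 => //; rewrite -nE !qk -intr_norm ltr_int.
    by have := strict on; rewrite {1}nE.
  by rewrite doubleS -nE qx mulr0 ltxx.
have nE : n = n./2.*2 by rewrite -[LHS]odd_double_half (negPf en).
rewrite big_ord_recl expr0 mulr1.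
have -> : \sum_(i < n) q`_(lift ord0 i) * x ^+ (lift ord0 i) =
    x * \sum_(k < n./2.*2) q`_k.+1 * x ^+ k.
  rewrite -nE mulr_sumr; apply: eq_bigr => k _.
  by rewrite lift0 exprS mulrCA.
have : 0 <= x * \sum_(k < n./2.*2) q`_k.+1 * x ^+ k.
  apply: (sum_pairs_ge0 _ (fun k => q`_k.+1)) => // j jm; apply: pairsR.
    by rewrite nE; lia.
  by rewrite oddB /= ?(negPf en) ?odd_double//; lia.
have : 0 < q`_0 by rewrite qk (lt_le_trans fnR).
by move=> h1 h2 h3; have := ltr_wpDr h2 h1; rewrite h3 ltxx.
Qed.

(** * Dominance from the two leading coefficients *)

Lemma geometric_sum4 (R : realDomainType) (n : nat) :
  3 * \sum_(k < n) 4 ^+ k <= 4 ^+ n :> R.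
Proof.
elim: n => [|n IH]; first by rewrite big_ord0 mulr0 expr0 ler01.
by rewrite big_ord_recr /= exprS; lra.
Qed.

(** At radius 4 the terms of degree at most [n] add up to at most [H * 4 ^+ n.+1 / 3], so the
    hypothesis multiplied by [4 ^+ n.+1 / 3] implies Pellet's inequality. *)
Lemma dominant_of_coef_bound (R : realType) (f : {poly int}) (n H : nat) :
  size f = n.+3 -> (forall k, (k <= n)%N -> `|f`_k| <= H%:Z) ->
  12 * `|f`_n.+2| + H%:Z < 3 * `|f`_n.+1| ->
  dominant (map_poly (intr : int -> R[i]) f).
Proof.
move=> sf bf hf.
pose q : {poly R} := map_poly intr f.
rewrite map_poly_intr_complex -/q.
have sq : size q = n.+3 by rewrite size_map_inj_poly ?rmorph0//; exact: intr_inj.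
have nq k : `|q`_k| = (`|f`_k|)%:~R by rewrite coef_map intr_norm.
apply: (@dominant_of_pellet R q 4 n) => //.
rewrite !nq.
have hS : \sum_(k < n.+1) `|q`_k| * 4 ^+ k <= H%:R * \sum_(k < n.+1) 4 ^+ k.
  rewrite mulr_sumr; apply: ler_sum => k _.
  rewrite ler_wpM2r ?exprn_ge0// nq -[H%:R]/(H%:Z%:~R) ler_int.
  by apply: bf; rewrite -ltnS.
have hG := ler_wpM2l (ler0n R H) (geometric_sum4 R n.+1).
have hf' : 12 * (`|f`_n.+2|)%:~R + H%:R < 3 * (`|f`_n.+1|)%:~R :> R.
  move: hf; rewrite -(ltr_int R) rmorphD /= !intrM.
  by [].
have T0 : (0 : R) < 4 ^+ n.+1 by rewrite exprn_gt0.
move: hf'; rewrite -(ltr_pM2r T0) [4 ^+ n.+2]exprS.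
move: hS hG; set S := \sum_(k < _) _ * _; set G := \sum_(k < _) _.
set T := 4 ^+ n.+1; set a := (`|f`_n.+2|)%:~R; set b := (`|f`_n.+1|)%:~R.
by move=> *; lra.
Qed.

(** * Counting through injective parametrizations *)

Lemma card_le_num_dominant (R : realType) (n H : nat) (T : finType)
    (A : {set T}) (g : T -> {poly int}) :
  {in A &, injective g} -> (forall t, t \in A -> dominant_box R n H (g t)) ->
  (#|A| <= num_dominant R n H)%N.
Proof.
move=> gI gA; rewrite /num_dominant cardE.
have -> : size (enum A) = #|` [fset g t | t in A]%fset|.
  by rewrite card_in_imfset //= ?enum_finmem ?cardE.
apply/fsubset_leq_card/fsubsetP => f /imfsetP[t /= tA ->].
by rewrite in_fset_set ?inE; [exact: gA | exact: finite_dominant_box].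
Qed.

(** The dominant polynomials and the image of [A] are disjoint subsets of the box of all coefficient
    vectors. *)
Lemma num_dominant_add_card_le (R : realType) (n H : nat) (T : finType)
    (A : {set T}) (g : T -> {poly int}) :
  {in A &, injective g} ->
  (forall t, t \in A -> [/\ (size (g t) <= n.+1)%N,
     forall k, (k <= n)%N -> `|(g t)`_k| <= H%:Z & ~ dominant_box R n H (g t)]) ->
  (num_dominant R n H + #|A| <= (2 * H).+1 ^ n.+1)%N.
Proof.
move=> gI gA.
pose p (a : {ffun 'I_n.+1 -> 'I_(2 * H).+1}) : {poly int} :=
  \poly_(i < n.+1) ((a (inord i) : nat)%:Z - H%:Z).
have p_surj (f : {poly int}) : (size f <= n.+1)%N ->
    (forall k, (k <= n)%N -> `|f`_k| <= H%:Z) -> exists a, f = p a.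
  move=> sf bf; exists [ffun i : 'I_n.+1 => inord (absz (f`_i + H%:Z))].
  apply/polyP => k; rewrite coef_poly; case: ltnP => hk; last first.
    by rewrite nth_default // (leq_trans sf).
  by have bk := bf k hk; rewrite ffunE !inordK//; lia.
pose X := [fset p a | a : {ffun 'I_n.+1 -> 'I_(2 * H).+1}]%fset.
have cX : (#|` X| <= (2 * H).+1 ^ n.+1)%N.
  apply: leq_trans (leq_imfset_card _ _ _) _.
  rewrite (_ : size _ = #|{ffun 'I_n.+1 -> 'I_(2 * H).+1}|) ?cardE//.
  by rewrite -cardE card_ffun !card_ord.
pose D := fset_set (dominant_box R n H).
pose N := [fset g t | t in A]%fset.
have -> : #|A| = #|` N| by rewrite card_in_imfset //= ?cardE.
apply: leq_trans cX.
have DN0 : (D `&` N = fset0)%fset.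
  apply/fsetP => f; rewrite in_fset0; apply/negP; rewrite in_fsetI => /andP[fD].
  case/imfsetP => t /= tA fE; have [_ _] := gA t tA; apply.
  by move: fD; rewrite in_fset_set ?inE ?fE; last exact: finite_dominant_box.
rewrite -[leqLHS]subn0 -(cardfs0 {poly int}) -DN0 -cardfsU.
apply/fsubset_leq_card/fsubsetP => f; rewrite in_fsetU => /orP[].
  rewrite in_fset_set ?inE; last exact: finite_dominant_box.
  move=> [sf bf _]; have [a ->] := p_surj f (eq_leq sf) bf.
  by apply/imfsetP; exists a.
case/imfsetP => t /= tA ->; have [s b _] := gA t tA.
by have [a ->] := p_surj _ s b; apply/imfsetP; exists a.
Qed.

(** * Counting for the lower bound *)

(* The hypothesis of [dominant_of_coef_bound] cuts out of the first quadrant the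
   triangle [a_1 > 4 a_0 + H / 3].  Rotating the part of the rectangle
   [0 <= i < m, 0 <= j < 2 m] above the line [j = 4 (m - i)] by half a turn maps
   the rectangle injectively into the triangle [0 <= j < 4 (m - i)]. *)
Definition fold_triangle (m i j : nat) : nat * nat :=
  if (j < 4 * (m - i))%N then (i, j) else (m.-1 - i, 4 * m - j.+1)%N.

Lemma fold_triangleP (m i j : nat) : (i < m)%N -> (j < 2 * m)%N ->
  ((fold_triangle m i j).1 < m)%N /\
  ((fold_triangle m i j).2 < 4 * (m - (fold_triangle m i j).1))%N.
Proof. by rewrite /fold_triangle => im jm; case: ifP => /= h; split; lia. Qed.

(** Rotated points land at height at least [2 * m], above all points that stay in place. *)
Lemma fold_triangle_inj (m i j i' j' : nat) :
  (i < m)%N -> (j < 2 * m)%N -> (i' < m)%N -> (j' < 2 * m)%N ->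
  fold_triangle m i j = fold_triangle m i' j' -> i = i' /\ j = j'.
Proof.
rewrite /fold_triangle => im jm im' jm'.
by case: ifP => h; case: ifP => h' []; lia.
Qed.

(** Four sign choices and [2 * m ^ 2] points of the rectangle give the two leading coefficients; the
    others are free. For [a_0 = i + 1] and [a_1 = H - j] with [j < 4 * (m - i)], the coefficient
    bound asks for [12 * i + 12 + 3 * j < 2 * H]; the left side is at most [12 * m + 9], whence
    [6 * m + 5 <= H]. *)
Lemma num_dominant_ge (R : realType) (n m H : nat) : (6 * m + 5 <= H)%N ->
  (8 * m ^ 2 * (2 * H).+1 ^ n.+1 <= num_dominant R n.+2 H)%N.
Proof.
move=> mH.
pose T := (bool * bool * ('I_m * 'I_(2 * m)) * {ffun 'I_n.+1 -> 'I_(2 * H).+1})%type.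
pose g (u : T) : {poly int} :=
  let: (s0, s1, (i, j), c) := u in
  \poly_(k < n.+3)
    if (k == n.+2)%N then (-1) ^+ s0 * ((fold_triangle m i j).1.+1)%:Z
    else if (k == n.+1)%N then (-1) ^+ s1 * (H%:Z - ((fold_triangle m i j).2)%:Z)
    else (c (inord k) : nat)%:Z - H%:Z.
have -> : (8 * m ^ 2 * (2 * H).+1 ^ n.+1)%N = #|[set: T]|.
  by rewrite cardsT !card_prod !card_bool card_ffun !card_ord; ring.
apply: (@card_le_num_dominant R n.+2 H T _ g).
- move=> [[[s0 s1] [i j]] c] [[[s0' s1'] [i' j']] c'] _ _ /polyP e.
  have [a1 a2] := fold_triangleP _ _ _ (ltn_ord i) (ltn_ord j).
  have [b1 b2] := fold_triangleP _ _ _ (ltn_ord i') (ltn_ord j').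
  have e0 := e n.+2; have e1 := e n.+1.
  rewrite !coef_poly ltnSn eqxx in e0.
  rewrite !coef_poly ltnW //= eqxx ltn_eqF // in e1.
  have ff : fold_triangle m i j = fold_triangle m i' j'.
    apply/eqP; rewrite -pair_eqE /=; move: {e}e0 e1 a1 a2 b1 b2.
    by case: s0 s0' s1 s1' => [] [] [] []; rewrite ?expr0 ?expr1; lia.
  have [/val_inj -> /val_inj ->] := fold_triangle_inj _ _ _ _ _
    (ltn_ord i) (ltn_ord j) (ltn_ord i') (ltn_ord j') ff.
  have -> : s0 = s0'.
    by move: {e}e0; rewrite ff; case: s0 s0' => [] []; rewrite ?expr0 ?expr1; lia.
  have -> : s1 = s1'.
    move: {e}e1 b1 b2; rewrite ff.
    by case: s1 s1' => [] []; rewrite ?expr0 ?expr1; lia.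
  congr (_, _); apply/ffunP => k; apply/val_inj => /=.
  have := e k; rewrite !coef_poly.
  have kn := ltn_ord k.
  have -> : (k < n.+3)%N by lia.
  have -> : (k == n.+2 :> nat) = false by lia.
  have -> : (k == n.+1 :> nat) = false by lia.
  by rewrite inord_val; lia.
move=> [[[s0 s1] [i j]] c] _.
have [a1 a2] := fold_triangleP _ _ _ (ltn_ord i) (ltn_ord j).
set f := g _.
have f0 : f`_n.+2 = (-1) ^+ s0 * ((fold_triangle m i j).1.+1)%:Z.
  by rewrite /f /g coef_poly ltnSn eqxx.
have f1 : f`_n.+1 = (-1) ^+ s1 * (H%:Z - ((fold_triangle m i j).2)%:Z).
  by rewrite /f /g coef_poly ltnW //= eqxx ltn_eqF.
have fk k : (k <= n)%N -> `|f`_k| <= H%:Z.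
  move=> kn; rewrite /f /g coef_poly.
  have -> : (k < n.+3)%N by lia.
  have -> : (k == n.+2) = false by lia.
  have -> : (k == n.+1) = false by lia.
  move: (nat_of_ord _) (ltn_ord (c (inord k))) => x hx.
  rewrite ler_norml; lia.
have sf : size f = n.+3.
  by rewrite /f /g size_poly_eq // eqxx; case: s0 {f f0 f1 fk} => /=; lia.
have n0 : `|f`_n.+2| = ((fold_triangle m i j).1.+1)%:Z.
  by rewrite f0 normrMsign.
have n1 : `|f`_n.+1| = H%:Z - ((fold_triangle m i j).2)%:Z.
  by rewrite f1 normrMsign ger0_norm //; lia.
split => //.
  move=> k; rewrite leq_eqVlt => /orP[/eqP ->|]; first by rewrite n0; lia.
  rewrite ltnS leq_eqVlt => /orP[/eqP ->|]; first by rewrite n1; lia.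
  by rewrite ltnS; exact: fk.
apply: (@dominant_of_coef_bound R f n H) => //.
by rewrite n0 n1; lia.
Qed.

(** * Counting for the upper bound *)

(* By symmetry, each of the coordinates in [s] is the largest equally often. *)
Lemma card_max_coord (I : finType) (H : nat) (x : I) (s : seq I)
    (B : {set {ffun I -> 'I_H}}) :
  (forall c z, z \in s -> c \in B -> [ffun i => c (tperm x z i)] \in B) ->
  x \in s ->
  (#|B| <= size s * #|[set c in B | all (fun y => (c y <= c x)%N) s]|)%N.
Proof.
move=> swapB xs.
pose M z := [set c in B | all (fun y => (c y <= c z)%N) s].
have cM z : z \in s -> (#|M z| <= #|M x|)%N.
  move=> zs; pose sw (c : {ffun I -> 'I_H}) := [ffun i => c (tperm x z i)].
  have swI : injective sw.
    move=> c c' /ffunP e; apply/ffunP => i.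
    by have := e (tperm x z i); rewrite !ffunE tpermK.
  rewrite -(card_imset _ swI); apply: subset_leq_card; apply/fintype.subsetP => _ /imsetP[c + ->].
  rewrite !inE => /andP[cB /allP hc]; rewrite swapB //=.
  apply/allP => y ys; rewrite !ffunE tpermL.
  by case: tpermP => [_|_|_ _]; exact: hc.
have {}cM : (\sum_(z <- s) #|M z| <= size s * #|M x|)%N.
  have -> : (size s * #|M x| = \sum_(z <- s) #|M x|)%N.
    by rewrite big_const_seq count_predT iter_addn_0 mulnC.
  rewrite big_seq [leqRHS]big_seq.
  exact: leq_sum.
apply: leq_trans cM.
(* Double counting: each [c] in [B] lies in at least one [M z], for [z] a coordinate in [s] where
   [c] is largest. *)
under eq_bigr do rewrite -sum1_card big_mkcond.
rewrite exchange_big /= -sum1_card big_mkcond /=.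
apply: leq_sum => c _; case: ifP => // cB.
have [z zs hz] : exists2 z, z \in s & all (fun y => (c y <= c z)%N) s.
  have [z zs hz] := @arg_maxnP _ x (mem s) (fun z => c z : nat) xs.
  by exists z => //; apply/allP => y ys; exact: hz.
rewrite (big_rem z) //= inE cB hz; exact: leq_addr.
Qed.

(* Apart from the lowest one or two coefficients, the coefficients come in pairs
   of degrees [i] and [i.+1] with [n - i] odd.  The map sending [(x, y)] to
   [(x - y, max x y + 1)] is a bijection of [0, H)^2 onto the pairs [(a, b)]
   with [|a| < b <= H]. *)
Definition paired_coef (n : nat) (c : nat -> nat) (i : nat) : int :=
  if (i <= odd n)%N then (c i).+1%:Z
  else if odd (n - i) then (c i)%:Z - (c i.+1)%:Z
  else (maxn (c i) (c i.-1)).+1%:Z.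

Lemma paired_coef_le (n H : nat) (c : nat -> nat) (i : nat) :
  (forall k, (c k < H)%N) -> `|paired_coef n c i| <= H%:Z.
Proof.
move=> cH; rewrite /paired_coef.
move: (cH i) (cH i.+1) (cH i.-1) => h1 h2 h3.
by case: ifP => _; [lia | case: ifP => _; rewrite ler_norml; lia].
Qed.

(** The sign of [x - y] tells which of [x] and [y] is the known maximum, and the difference then
    gives the other. *)
Lemma paired_coef_inj (n : nat) (c c' : nat -> nat) :
  (forall i, (i <= n)%N -> paired_coef n c i = paired_coef n c' i) ->
  forall i, (i <= n)%N -> c i = c' i.
Proof.
move=> e i iLn; have := e i iLn; rewrite /paired_coef.
case: leqP => [_|oi]; first by lia.
case: ifP => oni.
  have iln : (i < n)%N by rewrite ltn_neqAle iLn andbT; apply/eqP => ii; rewrite ii subnn in oni.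
  have := e i.+1 iln; rewrite /paired_coef leqNgt ltnW ?ltnS //=.
  have -> : odd (n - i.+1) = false by move: oni; rewrite subnS; case: (n - i)%N => //= k /negbTE.
  by lia.
case: i iLn oi oni => [//|i] iLn oi oni.
have [io|io] := leqP i (odd n).
  have {}oi : i = odd n by apply/eqP; rewrite eqn_leq io.
  by move: oni; rewrite oddB //= oi; case: (odd n).
have := e i (ltnW iLn); rewrite /paired_coef leqNgt io /=.
have -> : odd (n - i) by move: oni; rewrite !oddB ?(ltnW iLn) //=; case: (odd n) (odd i) => [] [].
by lia.
Qed.

Definition paired_poly (n : nat) (c : nat -> nat) : {poly int} :=
  \poly_(i < n.+1) paired_coef n c i.

(** The leading coefficient is one more than the maximum of [c n] and [c n.-1], so the first two
    inequalities say [a_0 <= a_n]; for odd [n] the third says [a_n <= a_(n-1)]. *)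
Lemma paired_poly_not_dominant (R : realType) (n : nat) (c : nat -> nat) (e : int) :
  (2 <= n)%N -> e != 0 -> (c n <= c 0)%N -> (c n.-1 <= c 0)%N ->
  (odd n -> (c 0 <= c 1)%N) ->
  ~ dominant (map_poly (intr : int -> R[i]) (e *: paired_poly n c)).
Proof.
move=> n2 e0 h0 h1 hodd.
have on : (odd n <= 1)%N by case: (odd n).
have cE k : (k <= n)%N -> (paired_poly n c)`_k = paired_coef n c k.
  by move=> kn; rewrite coef_poly ltnS kn.
have lcE : paired_coef n c n = (maxn (c n) (c n.-1)).+1%:Z.
  by rewrite /paired_coef subnn ifF //; lia.
have c0E : paired_coef n c 0 = (c 0).+1%:Z by [].
apply: (@not_dominant R n) => //.
- by lia.
- by rewrite size_poly_eq // lcE.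
- by rewrite cE // lcE.
- by rewrite !cE // lcE c0E lez_nat ltnS geq_max h0 h1.
- move=> i ilt oni; rewrite !cE //; last exact: ltnW.
  rewrite /paired_coef.
  have -> : odd (n - i.+1) = false.
    by move: oni; rewrite subnS; case: (n - i)%N => //= k /negbTE.
  (* Among the lowest, unpaired coefficients, [n - i] is odd only for [i = 0] and [n] odd. *)
  rewrite oni; case: (leqP i (odd n)) => [io|io].
    case: i ilt oni io => [|[|i]] ilt oni io; last by lia.
      by move: oni; rewrite subn0 => no; rewrite no /= lez_nat ltnS hodd.
    by exfalso; move: oni io; rewrite oddB; [case: (odd n) | exact: ltnW].
  rewrite /= ifF; last by lia.
  by rewrite ler_norml; lia.
- move=> no; rewrite !cE ?leq_pred // lcE /paired_coef no.
  have n3 : (3 <= n)%N by case: n n2 no {on cE lcE c0E hodd h0 h1} => [|[|[|]]].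
  rewrite ifF; last by lia.
  have -> : (n - n.-1 = 1)%N by lia.
  by rewrite /= prednK; [rewrite ltr_norml; lia | lia].
Qed.

(** The factor 2 counts each polynomial and its opposite, told apart by the sign of the leading
    coefficient. *)
Lemma num_dominant_le (R : realType) (n H : nat)
    (A : {set {ffun 'I_n.+1 -> 'I_H}}) :
  (2 <= n)%N ->
  (forall c, c \in A -> [/\ (c (inord n) <= c ord0)%N,
     (c (inord n.-1) <= c ord0)%N & odd n -> (c ord0 <= c (inord 1))%N]) ->
  (num_dominant R n H + 2 * #|A| <= (2 * H).+1 ^ n.+1)%N.
Proof.
move=> n2 hA.
pose T := (bool * {ffun 'I_n.+1 -> 'I_H})%type.
pose cc (c : {ffun 'I_n.+1 -> 'I_H}) (k : nat) : nat := c (inord k).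
pose g (u : T) : {poly int} := (-1) ^+ u.1 *: paired_poly n (cc u.2).
have -> : (2 * #|A| = #|finset.setX [set: bool] A|)%N.
  by rewrite cardsX cardsT card_bool.
have gE u k : (k <= n)%N -> (g u)`_k = (-1) ^+ u.1 * paired_coef n (cc u.2) k.
  by move=> kn; rewrite coefZ coef_poly ltnS kn.
have lc_gt0 c : 0 < paired_coef n c n.
  by rewrite /paired_coef subnn ifF //; case: (odd n); lia.
have sgn0 u : (-1) ^+ (u : bool) != 0 :> int by rewrite signr_eq0.
apply: (@num_dominant_add_card_le R n H T _ g).
- move=> [s c] [s' c'] _ _ /polyP e.
  have ss : s = s'.
    have := e n; rewrite !gE //=.
    move: (lc_gt0 (cc c)) (lc_gt0 (cc c')).
    by case: (s) (s') => [] []; rewrite ?expr0 ?expr1; lia.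
  rewrite ss; congr (_, _); apply/ffunP => k; apply/val_inj.
  have := @paired_coef_inj n (cc c) (cc c') _ k; rewrite /cc !inord_val.
  apply; last by rewrite -ltnS.
  move=> i iLn; have := e i; rewrite !gE //= ss.
  by move/mulfI; apply; exact: sgn0.
move=> [s c]; rewrite !inE /= => cA; have [h0 h1 h2] := hA c cA.
have ord0E : inord 0 = ord0 :> 'I_n.+1 by apply/val_inj; rewrite /= inordK.
split.
- by rewrite size_scale ?size_poly.
- by move=> k kn; rewrite gE //= normrMsign; apply: paired_coef_le => j; exact: ltn_ord.
move=> [_ _]; apply: paired_poly_not_dominant => //.
- by rewrite /cc ord0E.
- by rewrite /cc ord0E.
- by rewrite /cc ord0E.
Qed.

Lemma card_paired_even (n H : nat) : (0 < n)%N ->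
  exists2 A : {set {ffun 'I_n.+1 -> 'I_H}},
    forall c, c \in A -> (c (inord n) <= c ord0)%N /\ (c (inord n.-1) <= c ord0)%N
  & (H ^ n.+1 <= 3 * #|A|)%N.
Proof.
move=> n_gt0; pose s : seq 'I_n.+1 := [:: ord0; inord n.-1; inord n].
exists [set c in [set: {ffun 'I_n.+1 -> 'I_H}] | all (fun y => (c y <= c ord0)%N) s].
  by move=> c; rewrite !inE /= => /and4P[].
have := @card_max_coord 'I_n.+1 H ord0 s [set: _].
rewrite cardsT card_ffun !card_ord; apply; last by rewrite inE eqxx.
by move=> c z _ _; rewrite inE.
Qed.

(** Here [12 = 4 * 3]: first coordinate 1 is made largest of four, then coordinate 0 largest of the
    other three. The second symmetry argument runs inside [B], since transpositions within [s] fix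
    coordinate 1; this uses [1 < n.-1]. *)
Lemma card_paired_odd (n H : nat) : (3 <= n)%N ->
  exists2 A : {set {ffun 'I_n.+1 -> 'I_H}},
    forall c, c \in A -> [/\ (c (inord n) <= c ord0)%N,
      (c (inord n.-1) <= c ord0)%N & (c ord0 <= c (inord 1))%N]
  & (H ^ n.+1 <= 12 * #|A|)%N.
Proof.
move=> n3.
pose s : seq 'I_n.+1 := [:: ord0; inord n.-1; inord n].
pose s1 : seq 'I_n.+1 := inord 1 :: s.
pose B := [set c in [set: {ffun 'I_n.+1 -> 'I_H}] |
  all (fun y => (c y <= c (inord 1))%N) s1].
have hB : (H ^ n.+1 <= 4 * #|B|)%N.
  have := @card_max_coord 'I_n.+1 H (inord 1) s1 [set: _].
  rewrite cardsT card_ffun !card_ord; apply; last by rewrite inE eqxx.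
  by move=> c z _ _; rewrite inE.
exists [set c in B | all (fun y => (c y <= c ord0)%N) s].
  by move=> c; rewrite !inE /= => /andP[/and5P[_ h _ _ _] /and4P[]].
apply: leq_trans hB _; rewrite (_ : 12 = 4 * 3)%N // -mulnA leq_mul2l /=.
apply: (@card_max_coord _ _ ord0 s); last by rewrite inE eqxx.
move=> c z zs; rewrite !inE /= => /and5P[_ h0 h1 h2 _].
have v k : (k <= n)%N -> (inord k : 'I_n.+1) = k :> nat by move=> ?; rewrite inordK.
have hs y : y \in s -> (c y <= c (inord 1))%N.
  by rewrite !inE => /or3P[] /eqP ->.
have ns : inord 1 \notin s.
  by rewrite !inE -!val_eqE /= !v; lia.
have t1 : tperm ord0 z (inord 1) = inord 1.
  apply: tpermD; last by apply: contra ns => /eqP <-.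
  by apply: contra ns => /eqP <-; rewrite inE eqxx.
have ts y : y \in s -> tperm ord0 z y \in s.
  by case: tpermP => // _ _; rewrite inE eqxx.
by rewrite !ffunE t1 leqnn !hs ?ts ?inE ?eqxx ?orbT.
Qed.

(** * Limits inferior and superior *)

Lemma limn_esup_le_near (R : realType) (u : nat -> \bar R) (c : \bar R) (N : nat) :
  (forall k, (N <= k)%N -> (u k <= c)%E) -> (limn_esup u <= c)%E.
Proof.
move=> uc; rewrite /limn_esup /limf_esup.
apply: (@le_trans _ _ (ereal_sup (u @` [set k | (N <= k)%N]))).
  apply: ereal_inf_lbound; exists [set k | (N <= k)%N]%classic => //.
  exact: nbhs_infty_ge.
by apply: ub_ereal_sup => _ [k Nk <-]; exact: uc.
Qed.

Lemma le_limn_einf_near (R : realType) (u : nat -> \bar R) (c : \bar R) (N : nat) :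
  (forall k, (N <= k)%N -> (c <= u k)%E) -> (c <= limn_einf u)%E.
Proof.
move=> uc; rewrite /limn_einf leeNr.
by apply: (@limn_esup_le_near _ _ _ N) => k Nk; rewrite leeN2; exact: uc.
Qed.

(** By convexity the power lies below its chord on [[0, 1]], whose slope is [2 ^+ k - 1]; the
    induction is on this sharper bound. *)
Lemma expr1D_le (R : realDomainType) (k : nat) (x : R) : 0 <= x -> x <= 1 ->
  (1 + x) ^+ k <= 1 + 2 ^+ k * x.
Proof.
move=> x0 x1; suff : (1 + x) ^+ k <= 1 + (2 ^+ k - 1) * x by move=> h; lra.
elim: k => [|k IH]; first by rewrite !expr0; lra.
rewrite !exprSr; have x1' : 0 <= 1 + x by lra.
apply: le_trans (ler_wpM2r x1' IH) _.
have h1 : 1 <= 2 ^+ k :> R by rewrite exprn_ege1 //; lra.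
have : 0 <= (2 ^+ k - 1) * x * (1 - x) by rewrite !mulr_ge0 ?subr_ge0.
by move: (2 ^+ k) => y h; lra.
Qed.

(** With [m >= (H - 11) / 6] it suffices that [(H - 11)^2 >= 9/10 * H^2], which holds from [H = 220]
    on. *)
Lemma dominant_ratio_ge (R : realType) (n H : nat) : (220 <= H)%N ->
  1 / 20 <= dominant_ratio R n.+2 H.
Proof.
move=> H220; rewrite /dominant_ratio.
pose m := ((H - 5) %/ 6)%N.
have mH : (6 * m + 5 <= H)%N by rewrite /m; lia.
have Hm : (H <= 6 * m + 11)%N by rewrite /m; lia.
have HR : (220 : R) <= H%:R by rewrite (ler_nat R 220).
have HmR : (H%:R : R) <= 6 * m%:R + 11.
  by have := Hm; rewrite -(ler_nat R) natrD natrM.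
have := num_dominant_ge R n m H mH.
rewrite -(ler_nat R) !natrM !natrX => hD.
have X0 : (0 : R) < 2 * H%:R by lra.
rewrite ler_pdivlMr ?exprn_gt0//; apply: le_trans hD.
have hX : (2 * H%:R) ^+ n.+1 <= (2 * H).+1%:R ^+ n.+1 :> R.
  by rewrite lerXn2r ?nnegrE ?ler0n ?(ltW X0)// -natrM ler_nat.
rewrite exprSr in hX; rewrite (exprSr _ n.+2) (exprSr _ n.+1) (exprSr (2 * H%:R) n).
have hm : 2 * H%:R * (2 * H%:R) / 20 <= 8 * m%:R ^+ 2 :> R by nra.
have Y0 : (0 : R) <= (2 * H%:R) ^+ n by rewrite exprn_ge0 // ltW.
have Z0 : (0 : R) <= (2 * H%:R) ^+ n * (2 * H%:R) by rewrite mulr_ge0 // ltW.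
apply: (@le_trans _ _ (8 * m%:R ^+ 2 * ((2 * H%:R) ^+ n * (2 * H%:R)))).
  by have := ler_wpM2r Z0 hm; lra.
by rewrite ler_wpM2l // mulr_ge0 // exprn_ge0.
Qed.

(** The excluded polynomials number at least [2 * H ^ n.+1 / K], a share [1 / (K * 2 ^ n)] of
    [(2 * H) ^ n.+1]. The last term pays for replacing [2 * H + 1] by [2 * H]. *)
Lemma dominant_ratio_le (R : realType) (n K : nat) : (0 < K)%N ->
  (forall H, exists2 a : nat, (num_dominant R n H + 2 * a <= (2 * H).+1 ^ n.+1)%N
     & (H ^ n.+1 <= K * a)%N) ->
  forall H, (0 < H)%N ->
  dominant_ratio R n H <= 1 - 1 / (K%:R * 2 ^+ n) + 2 ^+ n.+1 / (2 * H%:R).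
Proof.
move=> K0 hK H H0; rewrite /dominant_ratio.
have [a h1 h2] := hK H.
have HR : (1 : R) <= H%:R by rewrite (ler_nat R 1).
have X0 : (0 : R) < 2 * H%:R by lra.
have KR : (0 : R) < K%:R by rewrite ltr0n.
have P0 : (0 : R) < 2 ^+ n by rewrite exprn_gt0.
rewrite ler_pdivrMr ?exprn_gt0//.
have e := @expr1D_le R n.+1 (2 * H%:R)^-1.
have {}e : (2 * H%:R + 1) ^+ n.+1 <=
    (1 + 2 ^+ n.+1 / (2 * H%:R)) * (2 * H%:R) ^+ n.+1 :> R.
  have -> : (2 * H%:R + 1 : R) = (1 + (2 * H%:R)^-1) * (2 * H%:R).
    by rewrite [RHS]mulrDl mul1r mulVf // gt_eqF.
  rewrite exprMn ler_wpM2r ?exprn_ge0 ?(ltW X0)//; apply: e.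
    by rewrite invr_ge0 ltW.
  by rewrite invf_le1 //; lra.
have {}h1 : (num_dominant R n H)%:R + 2 * a%:R <= (2 * H%:R + 1) ^+ n.+1 :> R.
  by have := h1; rewrite -(ler_nat R) natrD natrX -natr1 !natrM.
have {}h2 : 1 / (K%:R * 2 ^+ n) * (2 * H%:R) ^+ n.+1 <= 2 * a%:R :> R.
  have -> : 1 / (K%:R * 2 ^+ n) * (2 * H%:R) ^+ n.+1 = 2 * (H%:R ^+ n.+1 / K%:R) :> R.
    by rewrite exprMn [2 ^+ n.+1]exprS; field; rewrite !gt_eqF.
  rewrite ler_wpM2l // ler_pdivrMr // -natrX -natrM ler_nat mulnC.
  by rewrite mulnC in h2 *.
move: e h1 h2; set c := 1 / _; set d := _ / _; set P := _ ^+ n.+1.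
set Q := _ ^+ n.+1; move: c d P Q => c d P Q *; nra.
Qed.

Lemma limn_esup_dominant_ratio (R : realType) (n K : nat) : (0 < K)%N ->
  (forall H, exists2 a : nat, (num_dominant R n H + 2 * a <= (2 * H).+1 ^ n.+1)%N
     & (H ^ n.+1 <= K * a)%N) ->
  (limn_esup (fun H => (dominant_ratio R n H)%:E)
     <= (1 - 1 / (K%:R * 2 ^+ n))%:E)%E.
Proof.
move=> K0 hK; apply/lee_addgt0Pr => e e0.
have c0 : (0 : R) <= 2 ^+ n.+1 / e by rewrite divr_ge0 ?exprn_ge0 // ltW.
(* Beyond this threshold [H] exceeds [2 ^+ n.+1 / e], so the error term is at most [e]. *)
apply: (@limn_esup_le_near _ _ _ (Num.bound (2 ^+ n.+1 / e : R)).+1) => H hH.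
have H0 : (0 < H)%N by apply: leq_ltn_trans hH.
rewrite -EFinD lee_fin; apply: le_trans (dominant_ratio_le R n K K0 hK H H0) _.
have HR : (1 : R) <= H%:R by rewrite (ler_nat R 1).
rewrite lerD2l ler_pdivrMr; last by lra.
have := archi_boundP c0; rewrite ltr_pdivrMr // => hb.
have : ((Num.bound (2 ^+ n.+1 / e : R)).+1%:R : R) <= H%:R by rewrite ler_nat.
rewrite -addn1 natrD => hb'.
have : (Num.bound (2 ^+ n.+1 / e : R))%:R * e <= H%:R * e by rewrite ler_pM2r //; lra.
have : 0 <= H%:R * e by rewrite mulr_ge0 // ltW.
by move: hb; lra.
Qed.

Theorem theorem1p4 (R : realType) (n : nat) (hn : (2 <= n)%N) :
  ((1 / (3 * n%:R ^+ 2 * Num.sqrt (n%:R + 1)))%:E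
     <= limn_einf (fun H : nat => (dominant_ratio R n H)%:E))%E /\
  (limn_esup (fun H : nat => (dominant_ratio R n H)%:E)
     <= (upper_density R n)%:E)%E.
Proof.
split.
  apply: (@le_limn_einf_near _ _ _ 220) => H H220; rewrite lee_fin.
  case: n hn => [|[|n]] // _; apply: le_trans (dominant_ratio_ge R n H H220).
  have n2 : (2 : R) <= n.+2%:R by rewrite (ler_nat R 2).
  (* A rational lower bound for the square root of 3: [3 * 4 * 17 / 10 = 20.4] still exceeds 20. *)
  have s17 : 17 / 10 <= Num.sqrt (n.+2%:R + 1 : R).
    have h : (0 : R) <= 17 / 10 by lra.
    by rewrite -(ger0_norm h) -sqrtr_sqr ler_sqrt; lra.
  have n4 : (4 : R) <= n.+2%:R ^+ 2 by nra.
  rewrite ler_pdivrMr; last by rewrite !mulr_gt0 //; lra.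
  by nra.
rewrite /upper_density; case: (boolP (odd n)) => [on|en].
  have n3 : (3 <= n)%N by case: n hn on => [|[|[|]]].
  (* Since [12 * 2 ^ n = 3 * 2 ^ (n + 2)], it remains that [n + 2 <= (3 * n + 1) / 2], with equality
     at [n = 3]. *)
  apply: le_trans (limn_esup_dominant_ratio R n 12 isT _) _.
    move=> H; have [A hA cA] := card_paired_odd n H n3; exists #|A| => //.
    by apply: num_dominant_le => // c /hA[].
  rewrite lee_fin lerD2l lerN2 ler_pM2l // lef_pV2 ?posrE ?mulr_gt0 ?exprn_gt0//.
  have -> : (12 * 2 ^+ n : R) = 3 * 2 ^+ n.+2 by rewrite !exprS; ring.
  rewrite ler_pM2l // ler_eXn2l; last by lra.
  by move: on; lia.
(* Here the exponents satisfy [n <= 3 * n / 2 - 1], with equality at [n = 2]. *)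
apply: le_trans (limn_esup_dominant_ratio R n 3 isT _) _.
  move=> H; have [A hA cA] := card_paired_even n H (ltnW hn); exists #|A| => //.
  apply: num_dominant_le => // c /hA[h0 h1]; split=> //.
  by rewrite (negPf en).
rewrite lee_fin lerD2l lerN2 ler_pM2l // lef_pV2 ?posrE ?mulr_gt0 ?exprn_gt0//.
rewrite ler_pM2l // ler_eXn2l; last by lra.
by move: en; lia.
Qed.
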